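(* Let $X$ be a positive, real-valued, long-tailed random variable with continuous probability density function $f$ and hazard rate function $r$. Assume that either $\mathrm{E}[X]=\infty$, or the limits $\lim_{t\to\infty} r(t)$ and $\lim_{t\to\infty} t^2\cdot f(t)$ both exist. In both cases, restarts are useful for $X$, i.e., there is a $t>0$ such that $\mathrm{E}[X_t]<\mathrm{E}[X]$, where $X_t$ is the runtime with restarts after time $t$.
   Context: A positive, real-valued random variable $X$ is called long-tailed if and only if $\Pr[X>x]>0$ for all real $x>0$, and for all real $y>0$, $\lim_{x\to\infty} \frac{\Pr[X>x+y]}{\Pr[X>x]}=1$. The cumulative distribution function of $X$ is $F(t)=\Pr[X\le t]$. A probability density function of $X$ is a non-negative, integrable function $f$ with $F(t)=\int_{-\infty}^{t} f(u)\,\mathrm{d}u$ for all $t\in\mathbb{R}$. The hazard rate function of $X$ is $r(t)=\frac{f(t)}{1-F(t)}$ for $t>0$. Usefulness of restarts: think of $X$ as the random runtime of a randomized algorithm $\mathcal{A}$ on some input. For $t>0$, the algorithm $\mathcal{A}_t$ is obtained by restarting $\mathcal{A}$ after time $t$ if no solution was found, repeatedly and with independent runs; $X_t$ denotes the runtime of $\mathcal{A}_t$. Explicitly, let $Y_1,Y_2,\dots$ be independent copies of $X$ and $N=\min\{i\ge 1 : Y_i\le t\}$; then $X_t=(N-1)\,t+Y_N$ (with $X_t=\infty$ if $N=\infty$). Restarts are useful for $X$ if there is a $t>0$ such that $\mathrm{E}[X_t]<\mathrm{E}[X]$ (where $\mathrm{E}[X]=\infty$ is allowed). *)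

(* Defs.v *)
From HB Require Import structures.
From mathcomp Require Import all_boot all_order all_algebra.
From mathcomp Require Import all_classical all_reals all_analysis.

Set Implicit Arguments.
Unset Strict Implicit.
Unset Printing Implicit Defensive.

Import Order.TTheory GRing.Theory Num.Theory.
Import numFieldNormedType.Exports.

Local Open Scope classical_set_scope.
Local Open Scope ring_scope.

Definition long_tailed d (T : measurableType d) (R : realType)
    (P : probability T R) (X : {RV P >-> R}) : Prop :=
  (forall x : R, 0 < x -> (0 < ccdf X x)%E) /\
  (forall y : R, 0 < y ->
    fine (ccdf X (x + y)) / fine (ccdf X x) @[x --> +oo] --> (1 : R)).

Definition is_pdf d (T : measurableType d) (R : realType)
    (P : probability T R) (X : {RV P >-> R}) (f : R -> R) : Prop :=
  [/\ forall u, 0 <= f u,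
      (@lebesgue_measure R).-integrable [set: R] (EFin \o f) &
      forall t, cdf X t = (\int[@lebesgue_measure R]_(u in `]-oo, t]) (f u)%:E)%E].

(* Totalized to all t: division by zero yields 0 where cdf X t = 1. *)
Definition hazard_rate d (T : measurableType d) (R : realType)
    (P : probability T R) (X : {RV P >-> R}) (f : R -> R) (t : R) : R :=
  f t / (1 - fine (cdf X t)).

Definition mutually_independent d (T : measurableType d) (R : realType)
    (P : probability T R) (Y : nat -> {RV P >-> R}) : Prop :=
  forall (s : seq nat) (B : nat -> set R), uniq s ->
    (forall i, measurable (B i)) ->
    P (\bigcap_(i in [set` s]) (Y i @^-1` B i)) =
    (\prod_(i <- s) P (Y i @^-1` B i))%E.

(* The copies may live on another probability space than X. *)
Definition independent_copies d (T : measurableType d) (R : realType)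
    (P : probability T R) (X : {RV P >-> R})
    d' (T' : measurableType d') (P' : probability T' R)
    (Y : nat -> {RV P' >-> R}) : Prop :=
  mutually_independent Y /\
  forall (i : nat) (B : set R), measurable B ->
    distribution P' (Y i) B = distribution P X B.

(* Runs are numbered from 0: the least n with Y n w <= t is N - 1, the number
   of failed runs. *)
Definition restart_time d (T : measurableType d) (R : realType)
    (P : probability T R) (Y : nat -> {RV P >-> R}) (t : R) (w : T) : \bar R :=
  match pselect (exists n : nat, Y n w <= t) with
  | left ex => let n := ex_minn ex in (n%:R * t + Y n w)%:E
  | right _ => +oo%E
  end.

(* The law of X_t, hence E[X_t], depends only on that of X: t is chosen from X
   alone, and the inequality is required of every realization of the runs as
   independent copies of X. *)
Definition restarts_useful d (T : measurableType d) (R : realType)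
    (P : probability T R) (X : {RV P >-> R}) : Prop :=
  exists2 t : R, 0 < t &
    forall d' (T' : measurableType d') (P' : probability T' R)
      (Y : nat -> {RV P' >-> R}),
      independent_copies X Y ->
      (\int[P']_w restart_time Y t w < 'E_P[X])%E.

(* Main.v *)
(* Since X_t = sum_n 1{Y_0, ..., Y_(n-1) > t} min(Y_n, t), independence gives
   E[X_t] = E[min(X, t)] / Pr[X <= t], which is finite as soon as Pr[X <= t] > 0;
   this settles the case E[X] = oo.  If E[X] is finite, put y = 2 E[X] + 1. By
   long-tailedness, Pr[X > t + y] > Pr[X > t] / 2 for t large, whence
     E[X] - E[min(X, t)] >= y Pr[X > t + y] > E[X] Pr[X > t],
   that is, E[min(X, t)] < E[X] Pr[X <= t]. *)
Require Import Defs.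
From HB Require Import structures.
From mathcomp Require Import all_boot all_order all_algebra.
From mathcomp Require Import all_classical all_reals all_analysis.
From mathcomp Require Import measurable_realfun.
From mathcomp Require Import lra.
Import Order.TTheory GRing.Theory Num.Theory.
Import numFieldNormedType.Exports.
Local Open Scope classical_set_scope.
Local Open Scope ring_scope.

(* Unlike [ge0_le_integral], no measurability is required, so that it applies to
   [restart_time]. *)
Lemma le_integral_ge0_bound d (T : measurableType d) (R : realType)
    (mu : {measure set T -> \bar R}) (f g : T -> \bar R) :
  (forall x, (0 <= g x)%E) -> (forall x, (f x <= g x)%E) ->
  (\int[mu]_x f x <= \int[mu]_x g x)%E.
Proof.
move=> g0 fg; rewrite integralE.
apply: (@le_trans _ _ (\int[mu]_x f^\+ x)%E).
  by rewrite geeDl// oppe_le0 integral_ge0.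
(* Both integrals are now suprema over nonnegative simple functions, and a simple function below
   [f^\+] is also below [g]. *)
rewrite !ge0_integralTE//.
apply: le_ereal_sup => _ [h hf <-]; exists h => // x.
by apply: (le_trans (hf x)); rewrite funeposE ge_max fg g0.
Qed.

(** The first hypothesis expresses independence of [A] and [phi]: restricting [mu] to [A] and
    pushing it forward along [phi] yields [c] times [nu]. The claim is then the change of variables
    for this image measure. *)
Lemma integral_restr_comp d d2 (T : measurableType d) (U : measurableType d2)
    (R : realType)
    (mu : {measure set T -> \bar R}) (A : set T) (mA : measurable A)
    (phi : {mfun T >-> U}) (nu : {measure set U -> \bar R}) (c : {nonneg R})
    (g : U -> \bar R) :
  (forall B, measurable B -> mu (A `&` phi @^-1` B) = (c%:num%:E * nu B)%E) ->
  measurable_fun [set: U] g -> (forall x, (0 <= g x)%E) ->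
  (\int[mu]_(x in A) g (phi x) = c%:num%:E * \int[nu]_x g x)%E.
Proof.
move=> indep mg g0.
have mphi : measurable_fun [set: T] phi by [].
rewrite -ge0_integral_mscale//.
rewrite (@eq_measure_integral _ _ _ setT (pushforward (mrestr mu mA) phi)); last first.
  by move=> B mB _; rewrite /= /mscale -indep// /pushforward /mrestr setIC.
rewrite (ge0_integral_pushforward mphi)//.
rewrite preimage_setT.
have mgphi : measurable_fun [set: _] (g \o phi) by exact: measurableT_comp.
(* The restricted measure does not charge the complement of [A], so its integral can be cut down to
   [A], where it agrees with [mu]. *)
have mA0 : mrestr mu mA (~` A) = 0%E by rewrite /mrestr setICl measure0.
rewrite (ge0_negligible_integral (measurableC mA) measurableT mgphi _ mA0); last first.
  by move=> x _; exact: g0.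
rewrite setTD setCK.
apply: eq_measure_integral => B mB BA.
by rewrite /= /mrestr (setIidl BA).
Qed.

(* The truncation at 0 is needed because a copy of X is only almost surely
   positive. *)
Definition trunc {R : realType} (t x : R) : \bar R := (Num.max 0 (Num.min x t))%:E.

Lemma trunc_ge0 {R : realType} (t x : R) : (0 <= trunc t x)%E.
Proof. by rewrite lee_fin le_max lexx. Qed.

Lemma measurable_trunc {R : realType} (t : R) : measurable_fun [set: R] (trunc t).
Proof.
apply/measurable_EFinP; apply: measurable_maxr; first exact: measurable_cst.
by apply: measurable_minr; [exact: measurable_id|exact: measurable_cst].
Qed.

Section restart.
Context d (T : measurableType d) (R : realType) (P : probability T R).
Context (X : {RV P >-> R}).
Context d' (T' : measurableType d') (P' : probability T' R).
Context (Y : nat -> {RV P' >-> R}) (t : R).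
Hypothesis t_gt0 : 0 < t.

Definition failed (n : nat) : set T' := [set w | forall i, (i < n)%N -> t < Y i w].

Lemma measurable_failed n : measurable (failed n).
Proof.
rewrite (_ : failed n = \bigcap_(i in [set i | (i < n)%N]) (Y i @^-1` `]t, +oo[)).
  apply: bigcap_measurableType => i _.
  by rewrite -[X in measurable X]setTI; exact: measurable_funPT.
by apply/seteqP; split => w h i ilt; have := h i ilt; rewrite /= in_itv/= andbT.
Qed.

(** Run [n] takes place only on [failed n]; it costs [t] if it fails and [Y n w] if it succeeds.
    This is only an upper bound, since [trunc] raises a negative [Y n w] to 0. *)
Lemma restart_time_le w :
  (restart_time Y t w <= \sum_(n <oo) ((trunc t \o Y n) \_ (failed n)) w)%E.
Proof.
have term0 n : (0 <= ((trunc t \o Y n) \_ (failed n)) w)%E.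
  by rewrite erestrict_ge0// => x _; exact: trunc_ge0.
have term_t n : failed n.+1 w -> ((trunc t \o Y n) \_ (failed n)) w = t%:E.
  move=> fw; rewrite patchE mem_set; last by move=> i /ltnW; exact: fw.
  have tY : t <= Y n w by apply/ltW/fw.
  by rewrite /= /trunc min_r// max_r// ltW.
have sum_t n : failed n w ->
    (\sum_(0 <= i < n) ((trunc t \o Y i) \_ (failed i)) w = (n%:R * t)%:E)%E.
  elim: n => [|n ih] fw; first by rewrite big_nil mul0r.
  rewrite big_nat_recr//= ih; last by move=> i /ltnW; exact: fw.
  by rewrite term_t// -EFinD -[n.+1%:R]natr1 mulrDl mul1r.
rewrite /restart_time; case: pselect => [ex|nex].
  case: ex_minnP => n Ynt min_n.
  have fw : failed n w.
    by move=> i; apply: contraTT; rewrite -leNgt -leqNgt; exact: min_n.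
  apply: (le_trans _ (nneseries_lim_ge n.+1 _)) => //.
  rewrite big_nat_recr//= sum_t// EFinD leeD2l// patchE mem_set//.
  by rewrite /= /trunc min_l// lee_fin le_max lexx orbT.
(* No run succeeds: the partial sums [n%:R * t] are unbounded, so the series cannot be finite. *)
have fw n : failed n w.
  by move=> i _; rewrite ltNge; apply/negP => Yi; apply: nex; exists i.
rewrite leNgt; apply/negP => fin.
set S := (\sum_(n <oo) _)%E in fin.
have S0 : (0 <= S)%E by exact: nneseries_ge0.
have Sfin : S \is a fin_num by rewrite ge0_fin_numE.
have le n : (n%:R * t <= fine S).
  rewrite -lee_fin fineK// -sum_t//; exact: nneseries_lim_ge.
have := le (Num.bound (fine S / t)); rewrite leNgt -ltr_pdivrMr//.
by rewrite archi_boundP// divr_ge0 ?fine_ge0// ltW.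
Qed.

Hypothesis copies : independent_copies X Y.

Lemma failed_indep n (B : set R) : measurable B ->
  P' (failed n `&` Y n @^-1` B) =
    ((fine (ccdf X t) ^+ n)%:E * distribution P X B)%E.
Proof.
case: copies => indep dist mB.
(* The event constrains runs 0 to [n] separately: the first [n] exceed [t], and the last lies in
   [B]. *)
pose C i := if i == n then B else `]t, +oo[%classic.
have mC i : measurable (C i) by rewrite /C; case: ifP.
have -> : failed n `&` Y n @^-1` B = \bigcap_(i in [set` iota 0 n.+1]) (Y i @^-1` C i).
  have memI k : [set` iota 0 n.+1] k <-> (k <= n)%N by rewrite /mkset mem_iota.
  apply/seteqP; split => w.
    move=> [fw YB] i /memI iltn; rewrite /C /preimage /=.
    case: eqP => [->//|/eqP ni] /=.
    by rewrite in_itv/= andbT; apply: fw; rewrite ltn_neqAle ni.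
  move=> h; split.
    move=> i iltn; have /h : [set` iota 0 n.+1] i by apply/memI/ltnW.
    by rewrite /C /preimage /= (ltn_eqF iltn) /= in_itv/= andbT.
  have /h : [set` iota 0 n.+1] n by apply/memI.
  by rewrite /C /preimage /= eqxx.
rewrite indep ?iota_uniq//.
rewrite -[n.+1]addn1 iotaD big_cat /= big_seq1 add0n; congr (_ * _)%E.
  rewrite (eq_big_seq (fun=> ccdf X t)).
    rewrite big_const_seq count_predT size_iota.
    have -> : ccdf X t = (fine (ccdf X t))%:E by rewrite fineK// fin_num_measure.
    elim: n {C mC} => //= k ->; rewrite exprS EFinM.
    by rewrite fineK// fin_num_measure.
  move=> i; rewrite mem_iota add0n /= => iltn.
  by rewrite /ccdf -(dist i)// /C (ltn_eqF iltn).
by rewrite -(dist n)// /C eqxx.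
Qed.

(** Whether run [n] takes place depends on earlier runs only, so its expected cost is [m * s ^+ n].
    Summing the geometric series gives [m / (1 - s)]. *)
Lemma expectation_restart_le : fine (ccdf X t) < 1 ->
  (\int[P']_w restart_time Y t w <=
    (fine (\int[P]_w trunc t (X w)) / (1 - fine (ccdf X t)))%:E)%E.
Proof.
move=> s1; set s := fine _ in s1 *.
have s0 : 0 <= s by rewrite fine_ge0.
set m := fine (\int[P]_w _)%E.
(* The truncation is bounded by [t], so its expectation is finite and [fine] loses nothing. *)
have mE : (\int[P]_w trunc t (X w))%E = m%:E.
  rewrite fineK// ge0_fin_numE; last by apply: integral_ge0 => w _; exact: trunc_ge0.
  apply: (@le_lt_trans _ _ (\int[P]_w (cst t%:E w))%E).
    apply: le_integral_ge0_bound => w; rewrite lee_fin ?ge_max ?ge_min ?lexx ?orbT ?ltW//.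
  by rewrite integral_cst//= probability_setT mule1 ltry.
have mt n : measurable_fun [set: _] ((trunc t \o Y n) \_ (failed n)).
  apply/(measurable_restrictT _ (measurable_failed n)).
  by apply: measurable_funTS; apply: measurableT_comp => //; exact: measurable_trunc.
have t0 n w : (0 <= ((trunc t \o Y n) \_ (failed n)) w)%E.
  by rewrite erestrict_ge0// => x _; exact: trunc_ge0.
apply: (@le_trans _ _
    (\int[P']_w \sum_(n <oo) ((trunc t \o Y n) \_ (failed n)) w)%E).
  by apply: le_integral_ge0_bound => w; [exact: nneseries_ge0|exact: restart_time_le].
rewrite integral_nneseries//.
rewrite (eq_eseriesr (g := fun n => (geometric m s n)%:E)); last first.
  move=> n _.
  rewrite -integral_mkcond.
  have sn0 : 0 <= s ^+ n by rewrite exprn_ge0.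
  rewrite (@integral_restr_comp _ _ _ _ _ P' _ (measurable_failed n) (Y n)
    (distribution P X) (NngNum sn0) (trunc t)) /=.
  - rewrite (ge0_integral_distribution _ (measurable_trunc t) (trunc_ge0 t)).
    by rewrite mE -EFinM mulrC.
  - by move=> B mB; exact: failed_indep.
  - exact: measurable_trunc.
  - exact: trunc_ge0.
have := @cvg_geometric_series _ m s; rewrite ger0_norm// => /(_ s1) cv.
rewrite le_eqVlt; apply/orP; left; apply/eqP/cvg_lim => //.
apply: cvg_EFin; first by apply: nearW => n; rewrite sumEFin.
by apply: cvg_trans cv; apply: near_eq_cvg; apply: nearW => n; rewrite /= sumEFin.
Qed.
End restart.
Arguments expectation_restart_le {d T R P X d' T' P' Y t}.

Lemma long_tailed_restarts_useful d (T : measurableType d) (R : realType)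
    (P : probability T R) (X : {RV P >-> R}) :
  (forall w, 0 < X w) -> long_tailed X -> restarts_useful X.
Proof.
move=> X_pos [S_gt0 S_ratio].
have near_lt1 : \forall t \near +oo, fine (ccdf X t) < 1.
  exact: cvgr_lt (fine_cvg (cvg_ccdfy0 X)) _ ltr01.
have X_ge0 w : (0 <= (X w)%:E)%E by rewrite lee_fin ltW.
have truncX t w : 0 < t -> trunc t (X w) = (Num.min (X w) t)%:E.
  by move=> t0; rewrite /trunc max_r// le_min !ltW.
have [EX_fin|] := boolP ('E_P[X] \is a fin_num)%E; last first.
  rewrite ge0_fin_numE; last by rewrite unlock integral_ge0.
  rewrite -leNgt leye_eq => /eqP EXy.
  (* When the expectation of [X] is infinite, any threshold with a positive chance of success will
     do, as the restarted expectation is finite. *)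
  have [t [t_gt0 s1]] : exists t : R, 0 < t /\ fine (ccdf X t) < 1.
    near (pinfty_nbhs R) => t; exists t; split; last by near: t.
    by near: t; exact: nbhs_pinfty_gt.
  exists t => // d' T' P' Y copies; rewrite EXy.
  exact: le_lt_trans (expectation_restart_le t_gt0 copies s1) (ltry _).
set mu := fine 'E_P[X]%E.
have mu_ge0 : 0 <= mu by rewrite fine_ge0// unlock integral_ge0.
(* The factor 2 offsets the bound 1/2 on the ratio of tails below. The summand 1 makes [y] positive
   and the final inequality strict, given only [0 <= mu]. *)
pose y := 2 * mu + 1.
have y_gt0 : 0 < y by rewrite ltr_wpDl// mulr_ge0.
have [t [t_gt0 [s1 ratio]]] : exists t : R, 0 < t /\ fine (ccdf X t) < 1 /\
    2^-1 < fine (ccdf X (t + y)) / fine (ccdf X t).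
  near (pinfty_nbhs R) => t; exists t; split; last split; near: t => //.
    exact: nbhs_pinfty_gt.
  apply: (cvgr_gt _ (S_ratio y y_gt0)).
  by rewrite invf_lt1// ltr1n.
exists t => // d' T' P' Y copies.
apply: (le_lt_trans (expectation_restart_le t_gt0 copies s1)).
rewrite -[X in (_ < X)%E]fineK// -/mu lte_fin.
rewrite ltr_pdivrMr ?subr_gt0//.
set s := fine (ccdf X t) in s1 ratio *; set s' := fine (ccdf X (t + y)) in ratio *.
have s_gt0 : 0 < s by rewrite fine_gt0// S_gt0//= ltey_eq fin_num_measure.
set m := fine _.
suff : m + y * s' <= mu.
  move=> le_mu.
  have s's : s < 2 * s' by rewrite ltr_pdivlMr// mulrC ltr_pdivrMr// mulrC in ratio.
  have := ler_wpM2l mu_ge0 (ltW s's).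
  by rewrite /y in le_mu; lra.
have mtX : measurable_fun [set: T] (trunc t \o X).
  by apply: measurableT_comp; [exact: measurable_trunc|].
pose A := X @^-1` `]t + y, +oo[.
have mA : measurable A by rewrite -[A]setTI; exact: measurable_funPT.
(* Integrate the pointwise bound min(X, t) + y 1{X > t + y} <= X. *)
have EX_ge : (\int[P]_w trunc t (X w) + y%:E * ccdf X (t + y) <= 'E_P[X])%E.
  rewrite unlock.
  have -> : (y%:E * ccdf X (t + y) = \int[P]_w (y * \1_A w)%:E)%E.
    under eq_integral do rewrite EFinM.
    rewrite ge0_integralZl_EFin ?ltW//; last exact/measurable_EFinP.
    by rewrite integral_indic// setIT.
  rewrite -ge0_integralD//.
  - apply: le_integral_ge0_bound => // w.
    rewrite truncX// -EFinD lee_fin indicE.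
    have [wA|wA] := boolP (w \in A); last by rewrite mulr0 addr0 ge_min lexx.
    move: wA; rewrite inE /A /= in_itv/= andbT => /ltW tyX.
    by rewrite mulr1 min_r// (le_trans _ tyX)// lerDl ltW.
  - by move=> w _; exact: trunc_ge0.
  - by move=> w _; rewrite lee_fin mulr_ge0// ltW.
  - by apply/measurable_EFinP; apply: measurable_funM.
rewrite -lee_fin EFinD EFinM /m /s' /mu !fineK ?fin_num_measure//.
(* The truncated expectation is finite because [EX_ge] bounds it by that of [X]. *)
rewrite ge0_fin_numE; last by apply: integral_ge0 => w _; exact: trunc_ge0.
apply: le_lt_trans (_ : _ <= 'E_P[X])%E _; last by rewrite ltey_eq EX_fin.
by apply: le_trans EX_ge; rewrite leeDl// mule_ge0// lee_fin ltW.
Unshelve. all: by end_near.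
Qed.

Theorem theorem13 (R : realType) (d : measure_display) (T : measurableType d)
    (P : probability T R) (X : {RV P >-> R}) (f : R -> R)
    (X_pos : forall w : T, 0 < X w)
    (X_long_tailed : long_tailed X)
    (f_pdf : is_pdf X f)
    (f_cont : continuous f)
    (X_cases : ('E_P[X] = +oo)%E \/
       (cvg (hazard_rate X f t @[t --> +oo]) /\
        cvg (t ^+ 2 * f t @[t --> +oo]))) :
  restarts_useful X.
Proof. exact: long_tailed_restarts_useful. Qed.
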